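(* Let $\mathbb{A}$ be a non-empty set (not necessarily finite) and let $x=x_1x_2x_3\cdots\in\mathbb{A}^{\mathbb N}$ be an infinite word. Then $x$ is periodic if and only if for every $2$-colouring $\varphi:\mathbb{A}^+\to\{0,1\}$ there exists a $\varphi$-monochromatic factorisation of $x$, i.e., a factorisation $x=u_1u_2u_3\cdots$ with $u_i\in\mathbb{A}^+$ such that $\varphi(u_i)=\varphi(u_j)$ for all $i,j\geq 1$.
   Context: $\mathbb{A}^+$ denotes the free semigroup of all non-empty finite words over $\mathbb{A}$ (under concatenation), and $\mathbb{A}^{\mathbb N}$ the set of right-infinite words over $\mathbb{A}$. An infinite word $x$ is periodic if $x=uuu\cdots$ for some $u\in\mathbb{A}^+$. *)

(* Defs.v *)
From mathcomp Require Import all_boot.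

Set Implicit Arguments.
Unset Strict Implicit.
Unset Printing Implicit Defensive.

Definition word (A : Type) : Type := {u : seq A | ~~ nilp u}.

(* Letters are indexed from 0: [x i] is the letter x_{i+1}. *)
Definition infword (A : Type) : Type := nat -> A.

(* x = u_0 u_1 u_2 ... : every finite product u_0 ... u_{n-1} is a prefix of x.
   As the factors are non-empty, these prefixes have unbounded length, so u
   determines x. *)
Definition factorisation (A : Type) (x : infword A) (u : nat -> word A) : Prop :=
  forall n : nat,
    let p := flatten (mkseq (fun i => sval (u i)) n) in
    mkseq x (size p) = p.

Lemma factorisation_inj (A : Type) (x y : infword A) (u : nat -> word A) :
  factorisation x u -> factorisation y u -> x =1 y.
Proof.
move=> hx hy k.
set p := flatten (mkseq (fun i => sval (u i)) k.+1).
have lt_kp : k < size p.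
  rewrite /p; elim: k.+1 => [//|n IHn].
  rewrite mkseqS -cats1 flatten_cat size_cat /= cats0.
  rewrite -addn1 leq_add // lt0n.
  exact: (svalP (u n)).
have e : mkseq x (size p) = mkseq y (size p) by rewrite (hx k.+1) (hy k.+1).
by rewrite -(nth_mkseq (x 0) x lt_kp) e nth_mkseq.
Qed.

Lemma factorisation_exists (A : Type) (u : nat -> word A) :
  exists x : infword A, factorisation x u.
Proof.
pose pre n := flatten (mkseq (fun i => sval (u i)) n).
have preS n : pre n.+1 = pre n ++ sval (u n).
  by rewrite /pre mkseqS -cats1 flatten_cat /= cats0.
have size_pre n : n <= size (pre n).
  elim: n => [//|n IHn]; rewrite preS size_cat -addn1 leq_add // lt0n.
  exact: (svalP (u n)).
have a : A by case: (u 0) => -[].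
have pre_nth m d k : k < size (pre m) -> nth a (pre (m + d)) k = nth a (pre m) k.
  move=> lt_k; elim: d => [|d IHd]; first by rewrite addn0.
  rewrite addnS preS nth_cat IHd ifT //.
  apply: leq_trans lt_k _; elim: d {IHd} => [|d IHd]; first by rewrite addn0.
  by rewrite addnS preS size_cat (leq_trans IHd) // leq_addr.
exists (fun k => nth a (pre k.+1) k) => n /=.
apply: (@eq_from_nth _ a); rewrite size_mkseq // => k lt_k.
rewrite nth_mkseq // -/(pre n).
case: (leqP n k.+1) => [le_nk | /ltnW le_kn].
  by rewrite -(subnKC le_nk) pre_nth.
by rewrite -[in RHS](subnKC le_kn) pre_nth.
Qed.

Definition periodic (A : Type) (x : infword A) : Prop :=
  exists u : word A, factorisation x (fun _ => u).

Definition monochromatic_factorisation (A : Type) (phi : word A -> bool)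
    (x : infword A) (u : nat -> word A) : Prop :=
  factorisation x u /\ forall i j : nat, phi (u i) = phi (u j).

(* Main.v *)
(** If [x] is not periodic then [x <> ux] for every non-empty word [u].  Fix a
    total order on the letters and colour [u] according to whether [x < ux] or
    [ux < x] in the lexicographic order.  Left multiplication by a word is
    monotone, so if [x = u_0 u_1 u_2 ...] with, say, [x < u_i x] for all [i],
    then [x < u_0 x < u_0 u_1 x < u_0 u_1 u_2 x < ...].  But this sequence
    converges to [x], so it cannot stay above [u_0 x > x]. *)

Require Import Defs.
From mathcomp Require Import all_boot.
From mathcomp Require Import boolp wochoice.

Set Implicit Arguments.
Unset Strict Implicit.
Unset Printing Implicit Defensive.

Definition strict_total_order (A : Type) (R : A -> A -> Prop) : Prop :=
  [/\ forall a, ~ R a a,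
      forall b a c, R a b -> R b c -> R a c
    & forall a b, a <> b -> R a b \/ R b a].

(** The strict part of a well-order on [A], which exists by the axiom of choice. *)
Lemma strict_total_order_exists (A : Type) :
  exists R : A -> A -> Prop, strict_total_order R.
Proof.
have [R woR] := well_ordering_principle {classic A}.
have woT : wo_chain R (predT : {pred {classic A}}) by move=> B _; exact: woR.
have anti a b : R a b -> R b a -> a = b.
  by move=> ab ba; apply: (wo_chain_antisymmetric woT); rewrite // ab ba.
have tot a b : R a b || R b a by exact: (wo_chainW woT).
have trans b a c : R a b -> R b c -> R a c.
  move=> ab bc.
  (* Transitivity comes from the least element [z] of {a, b, c}: if it is [a], then [R a c] is
     immediate; if it is [b] or [c], antisymmetry identifies it with its predecessor in the
     chain. *)
  have [|z [[]]] := woR (mem [:: a; b; c]); first by exists a; exact: mem_head.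
  rewrite !inE => z_abc lez _.
  have za : R z a by apply: lez; rewrite !inE eqxx.
  have zb : R z b by apply: lez; rewrite !inE eqxx orbT.
  have zc : R z c by apply: lez; rewrite !inE eqxx !orbT.
  case/or3P: z_abc => /eqP ez; first by rewrite -ez.
    by rewrite (anti a b) // -ez.
  by rewrite -(anti b c) // -ez.
exists (fun a b => R a b /\ a <> b); split=> [a [] //|b a c|a b neq_ab].
  move=> [ab neq_ab] [bc _]; split; first exact: trans bc.
  by move=> eq_ac; apply: neq_ab; apply: anti => //; rewrite eq_ac.
by case/orP: (tot a b) => ?; [left | right; split=> // /esym].
Qed.

(** Reversing the order swaps the two colours, so one monotonicity argument handles both. *)
Lemma strict_total_order_flip (A : Type) (R : A -> A -> Prop) :
  strict_total_order R -> strict_total_order (fun a b => R b a).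
Proof.
move=> [irr trans tot]; split=> // [b a c ba cb|a b]; first exact: trans ba.
by move/tot=> []; [right | left].
Qed.

Section Lexicographic.

Variables (A : Type) (R : A -> A -> Prop).
Hypothesis orderR : strict_total_order R.

Definition lex (y z : infword A) : Prop :=
  exists k, (forall i, i < k -> y i = z i) /\ R (y k) (z k).

Lemma lex_irr y : ~ lex y y.
Proof. by case: orderR => irr _ _ [k [_ /irr]]. Qed.

Lemma lex_trans z y w : lex y z -> lex z w -> lex y w.
Proof.
case: orderR => _ trans _ [k [eqk ltk]] [l [eql ltl]].
case: (ltngtP k l) => [lt_kl|lt_lk|eq_kl].
- exists k; split=> [i lt_ik|]; last by rewrite -eql.
  by rewrite eqk // eql // (ltn_trans lt_ik).
- exists l; split=> [i lt_il|]; last by rewrite eqk.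
  by rewrite eqk ?eql // (ltn_trans lt_il).
- rewrite -eq_kl in eql ltl; exists k; split=> [i lt_ik|].
    by rewrite eqk ?eql.
  exact: trans ltl.
Qed.

Lemma lex_total y z : ~ y =1 z -> lex y z \/ lex z y.
Proof.
case: orderR => _ _ tot /existsNP[m neq_m].
have exP : exists n, `[< y n <> z n >] by exists m; apply/asboolP.
case: (ex_minnP exP) => k /asboolP neq_k mink.
have eqk i : i < k -> y i = z i.
  by move=> lt_ik; apply: contrapT => /asboolP/mink; rewrite leqNgt lt_ik.
case: (tot _ _ neq_k) => ltk; [left | right]; exists k; split=> // i lt_ik.
by rewrite eqk.
Qed.

(** The first difference decides the comparison, so the words below [z] form an open set in the
    prefix topology. This replaces any explicit passage to the limit. *)
Lemma lex_open y z : lex y z ->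
  exists n, forall y', (forall i, i < n -> y' i = y i) -> lex y' z.
Proof.
move=> [k [eqk ltk]]; exists k.+1 => y' eqy'; exists k.
split=> [i lt_ik|]; last by rewrite eqy'.
by rewrite eqy' ?eqk // ltnW.
Qed.

End Lexicographic.

Lemma lex_flip (A : Type) (R : A -> A -> Prop) (y z : infword A) :
  lex R y z -> lex (fun a b => R b a) z y.
Proof. by move=> [k [eqk ltk]]; exists k; split=> // i /eqk. Qed.

(** The default value of [nth] supplies the letters of [x] past the end of [u]. *)
Definition prepend (A : Type) (u : seq A) (x : infword A) : infword A :=
  fun k => nth (x (k - size u)) u k.

Lemma prepend_lt (A : Type) (a : A) (u : seq A) (x : infword A) k :
  k < size u -> prepend u x k = nth a u k.
Proof. by move=> lt_k; apply: set_nth_default. Qed.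

Lemma prepend_add (A : Type) (u : seq A) (x : infword A) k :
  prepend u x (size u + k) = x k.
Proof. by rewrite /prepend nth_default ?leq_addr // addKn. Qed.

Lemma prepend_cat (A : Type) (u v : seq A) (x : infword A) :
  prepend (u ++ v) x = prepend u (prepend v x).
Proof.
apply: funext => k; case: (ltnP k (size u)) => [lt_k|/subnKC <-].
  by rewrite /prepend nth_cat lt_k; apply: set_nth_default.
rewrite prepend_add /prepend nth_cat ltnNge leq_addr /= size_cat.
by rewrite addKn subnDA addKn.
Qed.

Lemma prepend_prefix (A : Type) (x y : infword A) (u : seq A) k :
  mkseq x (size u) = u -> k < size u -> prepend u y k = x k.
Proof. by move=> eu lt_k; rewrite (prepend_lt (x 0)) // -eu nth_mkseq. Qed.

Lemma prepend_fixed_prefix (A : Type) (x : infword A) (u : seq A) :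
  prepend u x = x -> mkseq x (size u) = u.
Proof.
move=> eux; apply: (@eq_from_nth _ (x 0)); rewrite size_mkseq // => k lt_k.
by rewrite nth_mkseq // -[LHS](congr1 (fun y => y k) eux) (prepend_lt (x 0)).
Qed.

Lemma lex_prepend (A : Type) (R : A -> A -> Prop) (u : seq A) (y z : infword A) :
  lex R y z -> lex R (prepend u y) (prepend u z).
Proof.
move=> [k [eqk ltk]]; exists (size u + k).
rewrite !prepend_add; split=> // i lt_i.
case: (ltnP i (size u)) => [lt_iu|le_ui]; first exact: set_nth_default.
move: lt_i; rewrite -(subnKC le_ui) ltn_add2l !prepend_add; exact: eqk.
Qed.

Definition factor_prefix (A : Type) (u : nat -> word A) n : seq A :=
  flatten (mkseq (fun i => sval (u i)) n).

Lemma factor_prefixS (A : Type) (u : nat -> word A) n :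
  factor_prefix u n.+1 = factor_prefix u n ++ sval (u n).
Proof. by rewrite /factor_prefix mkseqS -cats1 flatten_cat /= cats0. Qed.

Lemma size_factor_prefix (A : Type) (u : nat -> word A) n :
  n <= size (factor_prefix u n).
Proof.
elim: n => [//|n IHn]; rewrite factor_prefixS size_cat -addn1 leq_add // lt0n.
exact: (svalP (u n)).
Qed.

(** Iterating x = ux gives x = u^n x, so every power of [u] is a prefix of [x]. *)
Lemma prepend_fixed_periodic (A : Type) (x : infword A) (u : word A) :
  prepend (sval u) x = x -> periodic x.
Proof.
move=> eux; exists u => n; apply: prepend_fixed_prefix.
rewrite -/(factor_prefix (fun=> u) n).
elim: n => [|n IHn]; last by rewrite factor_prefixS prepend_cat eux.
by apply: funext => k; rewrite /prepend nth_nil subn0.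
Qed.

Lemma factorisation_not_increasing (A : Type) (R : A -> A -> Prop)
    (x : infword A) (u : nat -> word A) :
  strict_total_order R -> factorisation x u ->
  ~ (forall i, lex R x (prepend (sval (u i)) x)).
Proof.
move=> orderR fact_u ltu; pose z n := prepend (factor_prefix u n) x.
have ltz n : lex R (z n) (z n.+1).
  by rewrite /z factor_prefixS prepend_cat; apply: lex_prepend.
have z1E : z 1 = prepend (sval (u 0)) x by rewrite /z /factor_prefix /= cats0.
have lt1z n : lex R (z 1) (z n.+2).
  by elim: n => [|n IHn]; [exact: ltz | apply: (lex_trans orderR) IHn (ltz _)].
have [n open_x] := lex_open (ltu 0).
(* [z n.+2] begins with n+2 non-empty factors of [x], hence agrees with [x] on its first [n] letters
   and lies below [z 1]. The index n+2, rather than [n], makes [z 1] strictly smaller than it even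
   when n = 0. *)
apply: (lex_irr orderR (y := z 1)); apply: (lex_trans orderR) (lt1z n) _.
rewrite [in X in lex R _ X]z1E; apply: open_x => i lt_in.
apply: prepend_prefix (fact_u n.+2) _.
apply: leq_trans (size_factor_prefix u n.+2).
by rewrite ltnS (leq_trans (ltnW lt_in)).
Qed.

Theorem theorem1 (A : Type) (A_nonempty : inhabited A) (x : infword A) :
  periodic x <->
  forall phi : word A -> bool,
    exists u : nat -> word A, monochromatic_factorisation phi x u.
Proof.
split=> [[u fact_u] phi|mono]; first by exists (fun=> u).
apply: contrapT => aper; have [R orderR] := strict_total_order_exists A.
have [u [fact_u phi_u]] := mono (fun u => `[< lex R x (prepend (sval u) x) >]).
case: (boolP `[< lex R x (prepend (sval (u 0)) x) >]) => lt0.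
  apply: (factorisation_not_increasing orderR fact_u) => i.
  by apply/asboolP; rewrite (phi_u i 0).
apply: (factorisation_not_increasing
  (strict_total_order_flip orderR) fact_u) => i; apply: lex_flip.
(* The colour [false] only says that x < u_i x fails; aperiodicity excludes equality, which leaves
   u_i x < x. *)
have [|lt_i|//] := lex_total orderR (y := x) (z := prepend (sval (u i)) x).
  by move=> /funext eux; apply: aper; apply: (prepend_fixed_periodic (u := u i)).
by move: lt0; rewrite (phi_u 0 i) => /asboolPn.
Qed.
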